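(* Let $X$ be an infinite Tychonoff space. The following statements are equivalent: \begin{enumerate} \item $C_p(X)$ satisfies $S_{fin}(\mathcal{A},\mathcal{A})$; \item $X$ satisfies $S_{fin}(\mathcal{O},\mathcal{O})$ (the Menger property); \item $C_p(X)$ satisfies $S_{fin}(\mathcal{A}_f,\mathcal{A}_f)$ for every $f\in C(X)$; \item $C_p(X)$ satisfies $S_{fin}(\mathcal{A},\mathcal{A}_f)$ for every $f\in C(X)$; \item $C_p(X)$ satisfies $S_{fin}(\mathcal{D},\mathcal{A})$; \item $C_p(X)$ satisfies $S_{fin}(\{\mathcal{A}_n\}_{n\in\mathbb{N}},\mathcal{A})$; \item $C_p(X)$ satisfies $S_{fin}(\{\mathcal{A}_{n,f}\}_{n\in\mathbb{N}},\mathcal{A}_f)$ for every $f\in C(X)$; \item $C_p(X)$ satisfies $S_{fin}(\{\mathcal{A}_n\}_{n\in\mathbb{N}},\mathcal{A}_f)$ for every $f\in C(X)$. \end{enumerate}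
   Context: $\mathbb{N}$ is the set of positive integers. $C(X)$ is the set of continuous functions $X\to\mathbb{R}$, and $C_p(X)$ is $C(X)$ with the topology of pointwise convergence. Covers: a cover $\mathcal{U}$ of $X$ is always nontrivial, i.e. $X=\bigcup\mathcal{U}$ and $X\notin\mathcal{U}$. $\mathcal{O}$ is the family of all open covers of $X$. Families of subsets of $C_p(X)$: - $\mathcal{D}$ is the family of dense subsets of $C_p(X)$. - For $n\in\mathbb{N}$, a set $A\subseteq C_p(X)$ is $n$-dense in $C_p(X)$ if for all pairwise distinct $x_1,\dots,x_n\in X$ and all nonempty open sets $W_1,\dots,W_n\subseteq\mathbb{R}$ there is $f\in A$ with $f(x_i)\in W_i$ for $i=1,\dots,n$. $\mathcal{A}_n$ is the family of $n$-dense subsets of $C_p(X)$, and $\mathcal{A}=\mathcal{A}_1$. - For $f\in C(X)$ and $n\in\mathbb{N}$, a set $B\subseteq C_p(X)$ is $n$-dense at the point $f$ if for every $n$-element set $\{x_1,\dots,x_n\}\subseteq X$ and every $\epsilon>0$ there is $h\in B$ with $h(x_i)\in(f(x_i)-\epsilon,f(x_i)+\epsilon)$ for $i=1,\dots,n$. $\mathcal{A}_{n,f}$ is the family of subsets of $C_p(X)$ that are $n$-dense at $f$, and $\mathcal{A}_f=\mathcal{A}_{1,f}$. Selection principles: $S_{fin}(\mathcal{P},\mathcal{Q})$ means: for each sequence $(P_n:n\in\mathbb{N})$ of elements of $\mathcal{P}$ there is a sequence $(B_n)_{n\in\mathbb{N}}$ of finite sets with $B_n\subseteq P_n$ for each $n$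 and $\bigcup_{n\in\mathbb{N}}B_n\in\mathcal{Q}$. For a sequence of families $\{\mathcal{P}_n\}_{n\in\mathbb{N}}$, $S_{fin}(\{\mathcal{P}_n\}_{n\in\mathbb{N}},\mathcal{Q})$ means: for each sequence $(P_n:n\in\mathbb{N})$ with $P_n\in\mathcal{P}_n$ for each $n$, there is a sequence $(B_n)_{n\in\mathbb{N}}$ of finite sets with $B_n\subseteq P_n$ for each $n$ and $\bigcup_{n\in\mathbb{N}}B_n\in\mathcal{Q}$. *)

(* Defs.v *)
From HB Require Import structures.
From mathcomp Require Import all_boot all_order all_algebra.
From mathcomp Require Import all_classical reals topology normedtype.

Set Implicit Arguments.
Unset Strict Implicit.
Unset Printing Implicit Defensive.

Import Order.TTheory GRing.Theory Num.Theory.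
Import numFieldNormedType.Exports.

Local Open Scope classical_set_scope.
Local Open Scope ring_scope.

Definition tychonoff_space (X : topologicalType) : Prop :=
  hausdorff_space X /\ completely_regular_space X.

(* [{ptws X -> R}] carries the topology of pointwise convergence on all
   functions; C_p(X) has the topology induced on the continuous ones. *)
Definition Cp (R : realType) (X : topologicalType) : topologicalType :=
  initial_topology (id : continuousType X R -> {ptws X -> R}).

(* Covers are nontrivial: the whole space is not a member. *)
Definition open_covers (X : topologicalType) : set (set (set X)) :=
  [set U | [/\ U `<=` open, \bigcup_(V in U) V = [set: X] & ~ U [set: X]]].

Definition dense_sets (R : realType) (X : topologicalType) : set (set (Cp R X)) :=
  [set A | dense A].

Definition n_dense (R : realType) (X : topologicalType) (n : nat) :
    set (set (Cp R X)) :=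
  [set A | forall (x : 'I_n -> X) (W : 'I_n -> set R),
     injective x -> (forall i, open (W i) /\ W i !=set0) ->
     exists2 f : Cp R X, A f & forall i, W i (f (x i))].

Definition n_dense_at (R : realType) (X : topologicalType) (n : nat)
    (f : Cp R X) : set (set (Cp R X)) :=
  [set B | forall (F : set X) (e : R),
     (F #= `I_n)%card -> 0 < e ->
     exists2 h : Cp R X, B h & forall x, F x -> h x \in `]f x - e, f x + e[].

Arguments open_covers : clear implicits.
Arguments dense_sets : clear implicits.
Arguments n_dense : clear implicits.

(* Sequences are indexed by [nat] from 0, so the term of index [n] here is the
   term of index [n.+1] of a sequence indexed by the positive integers. *)
Definition Sfin_seq (T : Type) (P : nat -> set (set T)) (Q : set (set T)) : Prop :=
  forall A : nat -> set T, (forall n, P n (A n)) ->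
  exists B : nat -> set T,
    (forall n, finite_set (B n) /\ B n `<=` A n) /\ Q (\bigcup_n B n).

Definition Sfin (T : Type) (P Q : set (set T)) : Prop := Sfin_seq (fun=> P) Q.

(* Main.v *)
Require Import Defs.
From mathcomp Require Import all_boot all_order all_algebra.
From mathcomp Require Import all_classical reals topology normedtype.

(* Menger's property gives (3): for each [k], the sets
   [{x | |h x - f x| < 1/(k+1)}], for [h] in a set 1-dense at [f], form an open
   cover of [X], and countably many selections can be interleaved.  Applying (4)
   to the constant functions with rational values gives (1); all the other
   statements follow from (3), (4) or (1) by monotonicity.

   Conversely each statement yields finite selections that are 1-dense at [0]
   from sequences of sets that are n-dense for all [n], hence dense in C_p(X).
   For an open cover [U], the functions equal to [1] off a finite union of
   members of [U] form such a set, and a selection among them produces finite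
   subfamilies of the covers that cover [X]. *)

Set Implicit Arguments.
Unset Strict Implicit.
Unset Printing Implicit Defensive.

Import Order.TTheory GRing.Theory Num.Theory.
Import numFieldNormedType.Exports.

Local Open Scope classical_set_scope.
Local Open Scope ring_scope.

(** * Selection principles and indexed covers *)

Lemma Sfin_seq_subl (T : Type) (P P' : nat -> set (set T)) (Q : set (set T)) :
  (forall n, P' n `<=` P n) -> Sfin_seq P Q -> Sfin_seq P' Q.
Proof. by move=> P'P PQ A P'A; apply: PQ => n; exact: P'P. Qed.

Lemma Sfin_seq_subr (T : Type) (P : nat -> set (set T)) (Q Q' : set (set T)) :
  Q `<=` Q' -> Sfin_seq P Q -> Sfin_seq P Q'.
Proof.
by move=> QQ' PQ A /PQ[B [BA QB]]; exists B; split=> //; exact: QQ'.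
Qed.

(* Countably many instances of a selection principle are run in parallel by
   splitting the index set into countably many infinite parts. *)
Lemma Sfin_bigcap (I : countType) (T : Type) (P : set (set T))
    (Q : I -> set (set T)) :
  (forall i A B, A `<=` B -> Q i A -> Q i B) ->
  (forall i, Sfin P (Q i)) -> Sfin P (\bigcap_i Q i).
Proof.
move=> Qup PQ A PA.
have /choice[B BA] := fun i => PQ i (fun m => A (pickle (i, m))) (fun=> PA _).
(* An index that codes no pair selects nothing. *)
exists (fun n => if pickle_inv n is Some (i, m) then B i m else set0).
split=> [n|i _].
  case: pickle_inv (@pickle_invK (I * nat)%type n) => [[i m] /= <-|_].
    by have [] := BA i.
  by split=> //; exact: finite_set0.
apply: Qup (BA i).2 => h [m _ Bh].
by exists (pickle (i, m)) => //; rewrite pickleK_inv.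
Qed.

Lemma finite_subset_image (T U : Type) (f : T -> U) (A : set T) (C : set U) :
  finite_set C -> C `<=` f @` A ->
  exists B, [/\ finite_set B, B `<=` A & C `<=` f @` B].
Proof.
(* Choosing preimages needs a default value outside [C]; if [T] is empty, then so is [C]. *)
elim/Ppointed: T => T in f A *.
  move=> _ CA; exists set0; split=> // u /CA[t]; have := no t; case.
move=> Cfin CA.
have /choice[g gP] : forall u, exists t, C u -> A t /\ f t = u.
  move=> u; have [/CA[t At ftu]|nCu] := pselect (C u); first by exists t.
  by exists point.
exists (g @` C); split; first exact: finite_image.
- by move=> _ [u Cu <-]; have [] := gP u Cu.
- by move=> u Cu; exists (g u); [exists u|have [] := gP u Cu].
Qed.

(** Selecting indices keeps track of the functions behind a cover. If some [V k h] is the whole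
    space, the family is no admissible cover, but [h] alone suffices; otherwise finite selections
    from the images lift to indices. *)
Lemma Sfin_open_covers_indexed (X : topologicalType) (T : Type)
    (A : nat -> set T) (V : nat -> T -> set X) :
  Sfin (open_covers X) (open_covers X) ->
  (forall n h, A n h -> open (V n h)) ->
  (forall n x, exists2 h, A n h & V n h x) ->
  exists B : nat -> set T,
    (forall n, finite_set (B n) /\ B n `<=` A n) /\
    forall x, exists n, exists2 h, B n h & V n h x.
Proof.
move=> menger Vo Vcov.
have [[k [h Akh Vkh]]|noT] :=
    pselect (exists k, exists2 h, A k h & V k h = [set: X]).
  exists (fun n => if n == k then [set h] else set0); split=> [n|x].
    by case: eqP => [->|_]; split=> // y ->.
  by exists k, h; rewrite ?eqxx ?Vkh.
have covV n : open_covers X (V n @` A n).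
  split=> [_ [h Ah <-]||[h Ah VT]]; first exact: Vo Ah.
    by apply/seteqP; split=> // x _; have [h Ah Vx] := Vcov n x; exists (V n h).
  by apply: noT; exists n, h.
have [C [CA [_ Ccov _]]] := menger _ covV.
have /choice[B BP] := fun n => finite_subset_image (CA n).1 (CA n).2.
exists B; split=> [n|x]; first by have [] := BP n.
have [U [n _ CU] Ux] : (\bigcup_(U in \bigcup_n C n) U) x by rewrite Ccov.
have [_ _ /(_ _ CU)[h Bh UE]] := BP n.
by exists n, h; rewrite ?UE.
Qed.

(** Bridges two encodings: sets of [n] points in [n_dense_at], injective families in [n_dense]. *)
Lemma card_eq_II_range (T : Type) (n : nat) (F : set T) :
  (F #= `I_n)%card -> exists2 x : 'I_n -> T, injective x & range x = F.
Proof.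
rewrite (card_eqr card_II) => /card_esym/card_bijP[g [g' g'K gK]].
have inT (i : 'I_n) : i \in [set: 'I_n] by rewrite inE.
exists (fun i => val (g (SigSub (inT i)))).
  by move=> i j /val_inj/(can_inj g'K)/(congr1 val).
apply/seteqP; split=> [_ [i _ <-]|y Fy]; first exact: set_valP.
exists (val (g' (SigSub (mem_set Fy)))) => //.
by rewrite (_ : SigSub _ = g' (SigSub (mem_set Fy))) ?gK//; exact: val_inj.
Qed.

(** Enumerate points other than [x] and put [x] in front; this supplies the extra distinct points
    when a higher density is reduced to 1-density. *)
Lemma infinite_inj_nat (T : Type) (x : T) :
  infinite_set [set: T] -> exists2 u : nat -> T, injective u & u 0%N = x.
Proof.
move=> /infinite_setD/(_ (finite_set1 x))/infiniteP/card_leP[g].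
have inT (n : nat) : n \in [set: nat] by rewrite inE.
have gN n : val (g (SigSub (inT n))) <> x.
  by have [] := set_valP (g (SigSub (inT n))).
exists (fun n => if n is m.+1 then val (g (SigSub (inT m))) else x) => //.
case=> [|m] [|n] // => [/esym/gN//|/gN//|].
move=> /val_inj/(@inj _ _ setT g _ _ (in_setT _) (in_setT _)).
by move=> /(congr1 val)/= ->.
Qed.

(** * Continuous functions and 1-density *)

Section Cp.
Context (R : realType) (X : topologicalType).
Implicit Types (f h : Cp R X) (x : X).

Lemma Cp_continuous f : continuous (f : X -> R).
Proof. exact: cts_fun. Qed.

Lemma continuous_Cp (g : X -> R) : continuous g -> exists f, f = g :> (X -> R).
Proof. by move=> gc; exists (mkcts gc : continuousType X R). Qed.

Lemma n_dense_1P (A : set (Cp R X)) :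
  n_dense R X 1 A <->
  forall x (W : set R), open W -> W !=set0 -> exists2 h, A h & W (h x).
Proof.
split=> [dA x W Wo W0|dA x W _ Wo]; last first.
  have [Wo0 W0] := Wo ord0; have [h Ah Wh] := dA (x ord0) _ Wo0 W0.
  by exists h => // i; rewrite ord1.
have [|//|h Ah Wh] := dA (fun=> x) (fun=> W).
  by move=> i j _; rewrite !ord1.
by exists h => //; exact: Wh ord0.
Qed.

Lemma n_dense_at_1P f (A : set (Cp R X)) :
  n_dense_at 1 f A <->
  forall x (e : R), 0 < e -> exists2 h, A h & `|h x - f x| < e.
Proof.
split=> [dA x e e0|dA F e /card_eq_II_range[u _ <-] e0].
  have [h Ah hx] := dA [set x] e card_set1 e0.
  exists h => //; have := hx x erefl.
  by rewrite in_itv/= ltr_distl.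
have [h Ah hu] := dA (u ord0) e e0.
by exists h => // _ [i _ <-]; rewrite ord1 in_itv/= -ltr_distl.
Qed.

(** * From the Menger property to selections of 1-dense sets *)

Lemma Sfin_n_dense_at f :
  Sfin (open_covers X) (open_covers X) ->
  Sfin (n_dense_at 1 f) (n_dense_at 1 f).
Proof.
move=> menger.
(* With the radius fixed, a single sequence of covers suffices. *)
pose Q (k : nat) := [set A : set (Cp R X) |
  forall x, exists2 h, A h & `|h x - f x| < k.+1%:R^-1].
suff : Sfin (n_dense_at 1 f) (\bigcap_k Q k).
  apply: Sfin_seq_subr => A QA; apply/n_dense_at_1P => x e e0.
  have [k ke] : exists k, k.+1%:R^-1 < e.
    exists (Num.bound e^-1); rewrite invf_plt ?posrE//.
    by rewrite (lt_trans (archi_boundP _)) ?ltr_nat// ltW// invr_gt0.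
  have [h Ah hx] := QA k I x; exists h => //; exact: lt_trans ke.
apply: Sfin_bigcap => [k A B AB QA x|k A dA].
  by have [h Ah hx] := QA x; exists h => //; exact: AB.
have [n h Ah|n x|B [BA Bcov]] := @Sfin_open_covers_indexed X _ A
    (fun _ h => [set x | `|h x - f x| < k.+1%:R^-1]) menger.
- have dc : continuous (fun x => `|h x - f x|).
    by move=> x; apply: cvg_norm; apply: cvgB; exact: Cp_continuous.
  exact: (open_comp (in1W dc) (@open_lt _ _)).
- by have /n_dense_at_1P := dA n; apply; rewrite invr_gt0.
exists B; split=> // x; have [n [h Bh hx]] := Bcov x.
by exists h => //; exists n.
Qed.

Lemma Sfin_n_dense_1 :
  (forall f, Sfin (n_dense R X 1) (n_dense_at 1 f)) ->
  Sfin (n_dense R X 1) (n_dense R X 1).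
Proof.
move=> dA.
have /choice[c cE] : forall q : rat, exists f, f = cst (ratr q) :> (X -> R).
  move=> q; exact: (continuous_Cp (@cst_continuous X R (ratr q))).
(* A nonempty open [W] contains a ball around some rational [q], so approximating each constant
   [c q] at [x] is enough. *)
suff : Sfin (n_dense R X 1) (\bigcap_q n_dense_at 1 (c q)).
  apply: Sfin_seq_subr => A cA; apply/n_dense_1P => x W Wo W0.
  have [r [Wr [q _ qr]]] := dense_rat W0 Wo; rewrite -{}qr in Wr.
  have [e /= e0 qW] : nbhs (ratr q : R) W by exact: open_nbhs_nbhs.
  have /n_dense_at_1P/(_ x e e0)[h Ah hx] := cA q I.
  by exists h => //; apply: qW; rewrite /= distrC; move: hx; rewrite cE.
apply: Sfin_bigcap => // q A B AB /n_dense_at_1P qA; apply/n_dense_at_1P.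
by move=> x e /(qA x)[h Ah hx]; exists h => //; exact: AB.
Qed.

(** * Comparison of the notions of density *)

Lemma dense_n_dense_1 : dense_sets R X `<=` n_dense R X 1.
Proof.
move=> A dA; apply/n_dense_1P => x W Wo [r Wr].
have evo : open [set h : Cp R X | W (h x)].
  exists [set g : {ptws X -> R} | W (g x)] => //.
  have evx : continuous (fun g : {ptws X -> R} => g x).
    by move=> g; exact: (pointwise_cvgP _ _).1 cvg_id x.
  exact: open_comp (in1W evx) Wo.
have [c cE] := continuous_Cp (@cst_continuous X R r).
have [||h [Wh Ah]] := dA [set h | W (h x)].
- by exists c; rewrite /= cE.
- exact: evo.
by exists h.
Qed.

(** The basic neighbourhoods of [f], given by finitely many points and a radius, generate a filter
    [G] converging pointwise to [f]. Hence an open set around [f] contains one of them, and [A]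
    meets it. *)
Lemma n_dense_dense (A : set (Cp R X)) :
  (forall n, n_dense R X n A) -> dense_sets R X A.
Proof.
move=> dA O [f Of] [O' O'o O'E].
pose G : set_system {ptws X -> R} := filter_from
  [set p : seq X * R | 0 < p.2]
  (fun p => [set g | forall x, x \in p.1 -> `|f x - g x| < p.2]).
have GF : Filter G.
  apply: filter_from_filter; first by exists ([::], 1) => /=; exact: ltr01.
  move=> [s1 e1] [s2 e2] /= e10 e20.
  exists (s1 ++ s2, Order.min e1 e2); first by rewrite /= lt_min e10.
  move=> g gP; split=> x /= xs; have := gP x.
    by rewrite /= mem_cat xs lt_min => /(_ isT)/andP[].
  by rewrite /= mem_cat xs orbT lt_min => /(_ isT)/andP[].
have : {ptws, G --> (f : X -> R)}.
  apply/pointwise_cvgP => t W [e e0 fW].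
  exists ([:: t], e) => //= g gP; apply: fW; apply: gP; exact: mem_head.
move=> /(_ O')[].
  by apply: open_nbhs_nbhs; split => //; move: Of; rewrite -O'E.
move=> [s e] /= e0 sO.
(* Repetitions are removed because the points must be distinct; an empty list uses the case
   [n = 0]. *)
have [||h Ah hP] := dA _ (tnth (in_tuple (undup s)))
    (fun i => ball (f (tnth (in_tuple (undup s)) i)) e).
- by apply/tuple_uniqP/undup_uniq.
- move=> i; split; first exact: ball_open.
  by exists (f (tnth (in_tuple (undup s)) i)); exact: ballxx.
exists h; split=> //; rewrite -O'E; apply: sO => x.
by rewrite -mem_undup => /(tnthP (in_tuple _))[i ->]; exact: hP.
Qed.

Lemma n_dense_n_dense_at n f : n_dense R X n `<=` n_dense_at n f.
Proof.
move=> A dA F e /card_eq_II_range[x xI <-] e0.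
have [|h Ah hx] := dA x (fun i => ball (f (x i)) e) xI.
  by move=> i; split; [exact: ball_open|exists (f (x i)); exact: ballxx].
exists h => // _ [i _ <-]; rewrite in_itv/= -ltr_distl distrC.
exact: hx.
Qed.

(** Pad [x] with [n] further points on which the values are left free. *)
Lemma n_dense_leq n : infinite_set [set: X] ->
  n_dense R X n.+1 `<=` n_dense R X 1.
Proof.
move=> infX A dA; apply/n_dense_1P => x W Wo W0.
have [u uI u0] := infinite_inj_nat x infX.
have [||h Ah hW] := dA (fun i => u i) (fun i => if i == ord0 then W else setT).
- by move=> i j /uI/val_inj.
- move=> i; case: ifP => // _; split; first exact: openT.
  by exists 0.
by exists h => //; have := hW ord0; rewrite /= u0.
Qed.

Lemma n_dense_at_leq n f : infinite_set [set: X] ->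
  n_dense_at n.+1 f `<=` n_dense_at 1 f.
Proof.
move=> infX A dA; apply/n_dense_at_1P => x e e0.
have [u uI u0] := infinite_inj_nat x infX.
have [||h Ah hu] := dA (u @` `I_n.+1) e => //.
  by apply: inj_card_eq => i j _ _; exact: uI.
exists h => //; have := hu x; rewrite in_itv/= -ltr_distl; apply.
by exists 0%N.
Qed.

(** * From selections back to the Menger property *)

Lemma finite_interpolation (n : nat) (x : 'I_n -> X) (r : 'I_n -> R)
    (V : 'I_n -> set X) :
  tychonoff_space X -> injective x -> (forall i, open (V i) /\ V i (x i)) ->
  exists h, (forall i, h (x i) = r i) /\
    forall y, (forall i, ~ V i y) -> h y = 1.
Proof.
move=> [hX crX] xI Vx.
have /choice[g gP] : forall i, exists g : X -> R, [/\ continuous g, g (x i) = 0,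
    forall y, ~ V i y -> g y = 1 & forall j, j != i -> g (x j) = 1].
  (* Complete regularity separates [x i] from this closed set, which avoids [x i] because [x] is
     injective. *)
  move=> i; pose B := ~` V i `|` x @` [set j | j != i].
  have Bc : closed B.
    apply: closedU; first by apply: open_closedC; have [] := Vx i.
    have /accessible_finite_set_closed := hausdorff_accessible hX.
    by apply; apply: finite_image; exact: finite_finset.
  have Bx : ~ B (x i).
    by case=> [|[j /= + /xI ji]]; [case; have [] := Vx i|rewrite ji eqxx].
  have /(uniform_separatorP (R := R))[g [gc _ g0 g1]] := crX _ _ Bc Bx.
  exists g; split=> // [|y Vy|j ji].
  - by apply: g0; exists (x i).
  - by apply: g1; exists y => //; left.
  - by apply: g1; exists (x j) => //; right; exists j.
(* At [x i] only the term of index [i] survives, giving [r i]; off all the [V i] every term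
   vanishes, leaving 1. *)
have sc : continuous (fun y => 1 + \sum_i (r i - 1) * (1 - g i y)).
  move=> y; apply: cvgD; first exact: cvg_cst.
  apply: (cvg_big add_continuous) => i _.
  apply: cvgM; first exact: cvg_cst.
  by apply: cvgB; [exact: cvg_cst|have [gc _ _ _] := gP i; exact: gc].
have [h hE] := continuous_Cp sc.
exists h; split=> [i|y Vy]; rewrite hE.
  rewrite (bigD1 i)//= big1 => [|j ji].
    by have [_ -> _ _] := gP i; rewrite subr0 mulr1 addr0 addrC subrK.
  by have [_ _ _ ->] := gP j; rewrite ?subrr ?mulr0// eq_sym.
rewrite big1 ?addr0// => i _.
by have [_ _ -> //] := gP i; rewrite subrr mulr0.
Qed.

(* To an open cover [U] corresponds the set of functions equal to [1] off a
   finite union of members of [U]; a function of this set that is less than [1]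
   at [x] witnesses that [x] lies in its finite union. *)
Lemma n_dense_cover n (U : set (set X)) : tychonoff_space X ->
  open_covers X U ->
  n_dense R X n [set h | exists F : set (set X), [/\ finite_set F, F `<=` U &
    forall x, ~ (\bigcup_(V in F) V) x -> h x = 1]].
Proof.
move=> tX [Uo Ucov _] x W xI WP.
have /choice[V VP] : forall i, exists V, U V /\ V (x i).
  move=> i; have [V UV Vx] : (\bigcup_(V in U) V) (x i) by rewrite Ucov.
  by exists V.
have /choice[r rP] : forall i, exists r, W i r.
  by move=> i; have [_ [r Wr]] := WP i; exists r.
have [|h [hr hV]] := @finite_interpolation _ x r V tX xI.
  by move=> i; have [UV Vx] := VP i; split=> //; exact: Uo.
exists h => [|i]; last by rewrite hr.
exists (range V); split=> [|_ [i _ <-]|y Vy].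
- by apply: finite_image; exact: finite_finset.
- by have [] := VP i.
- by apply: hV => i Viy; apply: Vy; exists (V i) => //; exists i.
Qed.

Lemma Sfin_open_covers f : tychonoff_space X -> (forall x, f x = 0) ->
  Sfin [set A | forall n, n_dense R X n A] (n_dense_at 1 f) ->
  Sfin (open_covers X) (open_covers X).
Proof.
move=> tX f0 dA U UC.
have [B [BA /n_dense_at_1P Bf]]  :=
  dA _ (fun k n => @n_dense_cover n _ tX (UC k)).
(* The finite family depends on [k] as well as [h], since one function may be selected for several
   covers. *)
have /choice[F FP] : forall p : nat * Cp R X, exists F : set (set X),
    B p.1 p.2 -> [/\ finite_set F, F `<=` U p.1 &
      forall x, ~ (\bigcup_(V in F) V) x -> p.2 x = 1].
  move=> [k h]; have [/(BA k).2[F FP]|nB] := pselect (B k h); first by exists F.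
  by exists set0.
have FU k : \bigcup_(h in B k) F (k, h) `<=` U k.
  by move=> V [h Bh]; have [_ FU _] := FP (k, h) Bh; exact: FU.
exists (fun k => \bigcup_(h in B k) F (k, h)); split=> [k|].
  split=> //; apply: bigcup_finite => [|h Bh]; first by have [] := BA k.
  by have [] := FP (k, h) Bh.
split.
- by move=> V [k _ /FU UV]; have [+ _ _] := UC k; exact.
- apply/seteqP; split=> // x _.
  (* Within distance 1 of 0, [h x] cannot be 1, so [x] lies in the finite union attached to [h]. *)
  have [h [k _ Bh] hx] := Bf x 1 ltr01.
  have [_ _ h1] := FP (k, h) Bh; apply: contrapT => nx.
  move: hx; rewrite f0 h1 ?subr0 ?normr1 ?ltxx// => -[V FV Vx].
  by apply: nx; exists V => //; exists k => //; exists h.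
- by move=> [k _ /FU UT]; have [_ _] := UC k.
Qed.

End Cp.

(** * The cycle of equivalences *)

Theorem theorem3p4 (R : realType) (X : topologicalType)
  (tychonoffX : tychonoff_space X) (infiniteX : infinite_set [set: X]) :
  [<-> Sfin (n_dense R X 1) (n_dense R X 1);
       Sfin (open_covers X) (open_covers X);
       forall f : Cp R X, Sfin (n_dense_at 1 f) (n_dense_at 1 f);
       forall f : Cp R X, Sfin (n_dense R X 1) (n_dense_at 1 f);
       Sfin (dense_sets R X) (n_dense R X 1);
       Sfin_seq (fun n => n_dense R X n.+1) (n_dense R X 1);
       forall f : Cp R X, Sfin_seq (fun n => n_dense_at n.+1 f) (n_dense_at 1 f);
       forall f : Cp R X, Sfin_seq (fun n => n_dense R X n.+1) (n_dense_at 1 f)].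
Proof.
have [z zE] := continuous_Cp (@cst_continuous X R 0).
have z0 x : z x = 0 by rewrite zE.
pose menger := Sfin (open_covers X) (open_covers X).
(* Uniform return to the Menger property: the sources must admit all sets that are n-dense for every
   n, and the target must imply 1-density at 0. *)
have toM (P : nat -> set (set (Cp R X))) (Q : set (set (Cp R X))) :
    Q `<=` n_dense_at 1 z -> Sfin_seq P Q ->
    (forall n A, (forall m, n_dense R X m A) -> P n A) -> menger.
  move=> Qz PQ dP; apply: (Sfin_open_covers tychonoffX z0).
  exact: Sfin_seq_subl dP (Sfin_seq_subr Qz PQ).
have dz := @n_dense_n_dense_at R X 1 z.
have zz := @subset_refl _ (n_dense_at 1 z).
have M3 : menger -> forall f : Cp R X, Sfin (n_dense_at 1 f) (n_dense_at 1 f).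
  by move=> M f; exact: Sfin_n_dense_at.
have M4 : menger -> forall f : Cp R X, Sfin (n_dense R X 1) (n_dense_at 1 f).
  move=> M f; apply: Sfin_seq_subl (M3 M f) => _.
  exact: n_dense_n_dense_at.
have M1 : menger -> Sfin (n_dense R X 1) (n_dense R X 1).
  by move=> /M4; exact: Sfin_n_dense_1.
(* Apart from the step that starts at the Menger property, each implication first returns to it by
   [toM]. *)
tfae.
- by move=> /(toM _ _ dz); apply=> n A; exact.
- exact: M3.
- by move=> /(_ z)/(toM _ _ zz) M; apply: M4; apply: M => n A dA; exact: dz.
- move=> /(_ z)/(toM _ _ zz) M; apply: Sfin_seq_subl (M1 _) => [_|].
    exact: dense_n_dense_1.
  by apply: M => n A; exact.
- move=> /(toM _ _ dz) M; apply: Sfin_seq_subl (M1 _) => [n|].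
    by move=> A; exact: n_dense_leq.
  by apply: M => n A; exact: n_dense_dense.
- move=> /(toM _ _ dz) M f; apply: Sfin_seq_subl (M3 _ f) => [n|].
    by move=> A; exact: n_dense_at_leq.
  by apply: M => n A; exact.
- move=> /(_ z)/(toM _ _ zz) M f; apply: Sfin_seq_subl (M4 _ f) => [n|].
    by move=> A; exact: n_dense_leq.
  by apply: M => n A dA; exact: n_dense_n_dense_at.
- by move=> /(_ z)/(toM _ _ zz) M; apply: M1; apply: M => n A; exact.
Qed.
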